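(* Let $(W,S)$ be a finite Coxeter system. Let $v,w\in W$ be such that $v\leq w$. Let $s_{\beta_1}\cdots s_{\beta_\ell}$ be a reduced expression of $w_ov$. Let $\alpha_i=s_{\beta_\ell}\cdots s_{\beta_{i+1}}(\beta_i)$ for all $1\leq i\leq\ell$. Then \[ \partial_{w/v}=\sum_J\prod_{j\in J}\partial_{\alpha_j}, \] where the sum ranges over all subsets $J$ of $\{1,\ldots,\ell\}$ such that the product $\prod_{j\in\bar J}s_{\beta_j}$ is a reduced expression of $w_ow$. Here $\bar J$ denotes the complement of $J$ in $\{1,\ldots,\ell\}$.
   Context: Coxeter setup. $(W,S)$ is a Coxeter system with $W$ finite; $m(s,s')$ is the order of $ss'$. $\mathfrak h_{\mathbb R}$ is a real vector space with basis $\Delta$ (the simple roots), in bijection with $S$ via $\beta\mapsto s_\beta$, with symmetric bilinear form $B(\beta,\beta')=-\cos(\pi/m(s_\beta,s_{\beta'}))$. $W$ acts by $s_\beta(x)=x-2B(x,\beta)\beta$, and $B$ is a $W$-invariant scalar product. $R=\{u(\beta):u\in W,\beta\in\Delta\}$ is the root system, $R^+$ the set of roots that are nonnegative linear combinations of $\Delta$. For $\alpha=u(\beta)\in R$, $s_\alpha=us_\beta u^{-1}$. $\ell(\cdot)$ is the length function, $\leq$ the (strong) Bruhat order, $w_o$ the longest element of $W$. Products $\prod_{j\in J}$ over a finite set $J$ of integers are taken in increasing order of the index (empty product $=1$). Coinvariant algebra and operators. $\mathfrak h=\mathfrak h_{\mathbb R}\otimes\mathbb C$, $S(\mathfrak h)$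 is the symmetric algebra with its $W$-action, $I_W$ the ideal generated by the $W$-invariant polynomials without constant term, and $S_W=S(\mathfrak h)/I_W$. For $\alpha\in R$, $\partial_\alpha=\frac{1-s_\alpha}{\alpha}$ is the $\mathbb C$-linear endomorphism of $S_W$ induced by $f\mapsto (f-s_\alpha f)/\alpha$ on $S(\mathfrak h)$. Skew divided difference operators: for $v\leq w$, fix a reduced expression $s_{\gamma_1}\cdots s_{\gamma_k}$ of $w$; for $J\subseteq\{1,\ldots,k\}$ let $\partial_J=\delta_1\cdots\delta_k$, where $\delta_j=s_{\gamma_j}$ (acting on $S_W$) if $j\in J$ and $\delta_j=\partial_{\gamma_j}$ if $j\notin J$; then $\partial_{w/v}=v^{-1}\sum_J\partial_J$, the sum over all $J$ such that $\prod_{j\in J}s_{\gamma_j}$ is a reduced expression of $v$ (independent of the reduced expression of $w$). For $v\not\leq w$, $\partial_{w/v}=0$. *)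

(* Defs.v *)
From HB Require Import structures.
From mathcomp Require Import all_boot all_order all_fingroup all_algebra.
From mathcomp Require Import generic_quotient ring_quotient mxrepresentation.
From mathcomp Require Import mpoly complex.
From mathcomp Require Import boolp classical_sets reals trigo.

Set Implicit Arguments.
Unset Strict Implicit.
Unset Printing Implicit Defensive.

Import GRing.Theory.
Local Open Scope ring_scope.

(* A Coxeter system (W, S) with W finite. The generators are indexed
   injectively by 'I_cox_rank, an index set which also plays the role of the
   set of simple roots. By the last field, W has the presentation
   < S | (s t)^m(s,t) = 1 > with m(s,t) = #[s * t]; it is stated as a universal
   property with respect to all (possibly infinite) groups H. *)
Record finCoxeterSystem := FinCoxeterSystem {
  cox_group :> finGroupType;
  cox_rank : nat;
  simple_refl : 'I_cox_rank -> cox_group;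
  simple_inj : injective simple_refl;
  simple_order : forall i, #[simple_refl i]%g = 2%N;
  simple_gen : (<<[set simple_refl i | i : 'I_cox_rank]>> = [set: cox_group])%g;
  simple_presentation : forall (H : groupType) (f : 'I_cox_rank -> H),
    (forall i j, ((f i * f j) ^+ #[simple_refl i * simple_refl j] = 1)%g) ->
    exists phi : cox_group -> H,
      {morph phi : x y / (x * y)%g} /\ forall i, phi (simple_refl i) = f i
}.

Section CoxeterGroup.

Variable W : finCoxeterSystem.
Notation I := 'I_(cox_rank W).
Implicit Types (b : seq I) (u v w : W).

Definition word_prod b : W := (\prod_(i <- b) simple_refl i)%g.

Lemma length_exists w :
  exists k, [exists b : k.-tuple I, word_prod b == w].
Proof.
have /gen_prodgP[k [c cS ->]] : w \in <<[set simple_refl i | i : I]>>%g.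
  by rewrite simple_gen inE.
have cS' (j : 'I_k) : exists i : I, c j == simple_refl i.
  by have /imsetP[i _ ->] := cS j; exists i.
exists k; apply/existsP; exists [tuple xchoose (cS' j) | j < k].
rewrite /word_prod big_tuple; apply/eqP; apply: eq_bigr => j _.
by rewrite tnth_mktuple; apply/esym/eqP/(xchooseP (cS' j)).
Qed.

Definition cox_length w : nat := ex_minn (length_exists w).

Definition reduced_expr b w : bool :=
  (word_prod b == w) && (size b == cox_length w).

Lemma reduced_word_exists w :
  exists b : (cox_length w).-tuple I, word_prod b == w.
Proof. by rewrite /cox_length; case: ex_minnP => k /existsP. Qed.

Definition reduced_word w : seq I := xchoose (reduced_word_exists w).

Definition longest_elt : W := [arg max_(w > (1%g : W)) cox_length w]%N.

Definition reflections : {set W} := [set (simple_refl ui.2 ^ ui.1)%g | ui : W * I].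

Definition bruhat_step u v : bool :=
  [exists t in reflections, v == (u * t)%g] && (cox_length u < cox_length v)%N.

Definition bruhat v w : bool := connect bruhat_step v w.

(* The subword of b on the positions in J, in increasing order. *)
Definition subword b (J : {set 'I_(size b)}) : seq I :=
  [seq tnth (in_tuple b) j | j <- enum J].

End CoxeterGroup.

Section CoinvariantAlgebra.

Variables (R : realType) (W : finCoxeterSystem).
Notation n := (cox_rank W).
Notation hR := 'cV[R]_n.
Notation Sh := {mpoly R[i][n]}.

Definition simple_root (i : 'I_n) : hR := delta_mx i 0.

Definition gram : 'M[R]_n :=
  \matrix_(i, j) - cos (pi / (#[simple_refl i * simple_refl j]%g)%:R).

Definition Bform (x y : hR) : R := (x^T *m gram *m y) 0 0.

(* W acts on h_R from the left by matrices multiplying column vectors. As W is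
   generated by the simple reflections, at most one representation rho is
   geometric, and one exists because the defining relations of W hold for these
   reflections. *)
Definition is_geometric (rho : mx_representation R [set: W] n) : Prop :=
  forall i (x : hR), rho (simple_refl i) *m x =
    x - (2 * Bform x (simple_root i)) *: simple_root i.

Variable rho : mx_representation R [set: W] n.

(* S(h) is the polynomial ring over C in the simple roots; h_R is embedded as
   linear forms with real coefficients. *)
Definition linear_form (x : hR) : Sh := \sum_(j < n) (x j 0)%:C%C *: 'X_j.

Definition actS (u : W) (f : Sh) : Sh :=
  comp_mpoly [tuple linear_form (rho u *m simple_root i) | i < n] f.

Definition W_invariant (f : Sh) : Prop := forall u : W, actS u f = f.

Definition coinv_ideal (f : Sh) : bool :=
  `[< exists l : seq (Sh * Sh),
        (forall gh, gh \in l -> W_invariant gh.2 /\ gh.2@_0%MM = 0) /\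
        f = \sum_(gh <- l) gh.1 * gh.2 >].

Lemma coinv_idealP : idealr_closed coinv_ideal.
Proof.
split.
- by apply/asboolP; exists [::]; split=> //; rewrite big_nil.
- apply/negP => /asboolP[l [lP l1]].
  have : (1 : Sh)@_0%MM = 0.
    rewrite l1 raddf_sum /= big_seq big1 // => gh /lP[_ gh0].
    by rewrite rmorphM /= gh0 mulr0.
  by rewrite mcoeff1 eqxx => /eqP; rewrite oner_eq0.
- move=> a f g /asboolP[l [lP ->]] /asboolP[l' [l'P ->]]; apply/asboolP.
  exists ([seq (a * gh.1, gh.2) | gh <- l] ++ l'); split.
    move=> gh; rewrite mem_cat => /orP[/mapP[gh' /lP ? ->]|/l'P] //.
  rewrite big_cat big_map mulr_sumr /=; congr (_ + _).
  by apply: eq_bigr => gh _; rewrite mulrA.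
Qed.

HB.instance Definition _ := isIdealr.Build Sh coinv_ideal coinv_idealP.

Definition coinvariant := {ideal_quot (coinv_ideal : idealr Sh)}.
HB.instance Definition _ := GRing.ComNzRing.on coinvariant.
HB.instance Definition _ := Quotient.on coinvariant.

(* s_alpha = u s_beta u^-1 for some u and beta with alpha = u(beta); it depends
   only on the root alpha. The value on vectors which are not roots is junk. *)
Definition root_reflection (alpha : hR) : W :=
  if [pick ui : W * 'I_n | rho ui.1 *m simple_root ui.2 == alpha] is Some ui
  then (ui.1 * simple_refl ui.2 * ui.1^-1)%g else 1%g.

(* The quotient (f - s_alpha f) / alpha, which for a root alpha exists and is
   unique. *)
Definition divdiffS (alpha : hR) (f : Sh) : Sh :=
  xget 0 (fun g => linear_form alpha * g = f - actS (root_reflection alpha) f).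

(* Endomorphisms induced on the quotient: lift_op1 applies an operator of S(h)
   to a representative, whose choice is irrelevant since the operators below
   are additive and preserve the ideal. *)
Definition coinv_act (u : W) : coinvariant -> coinvariant :=
  lift_op1 coinvariant (actS u).

Definition coinv_divdiff (alpha : hR) : coinvariant -> coinvariant :=
  lift_op1 coinvariant (divdiffS alpha).

(* Composite of the operators F_j, j in J, in increasing order of j from left
   to right (so that the operator of largest index is applied first). *)
Definition comp_ops k (J : {set 'I_k}) (F : 'I_k -> coinvariant -> coinvariant) :
    coinvariant -> coinvariant :=
  \big[@comp coinvariant coinvariant coinvariant/id]_(j in J) F j.

Definition skew_summand (c : seq 'I_n) (J : {set 'I_(size c)}) :
    coinvariant -> coinvariant :=
  comp_ops [set: 'I_(size c)] (fun j =>
    let i := tnth (in_tuple c) j in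
    if j \in J then coinv_act (simple_refl i) else coinv_divdiff (simple_root i)).

Definition skew_divdiff (w v : W) (x : coinvariant) : coinvariant :=
  if bruhat v w then
    let c := reduced_word w in
    coinv_act v^-1%g (\sum_(J : {set 'I_(size c)} | reduced_expr (subword J) v)
                  skew_summand J x)
  else 0.

(* For b = (beta_1, ..., beta_l) and the 0-based position j of beta_i in b,
   this is s_{beta_l} ... s_{beta_(i+1)} (beta_i). *)
Definition word_root (b : seq 'I_n) (j : 'I_(size b)) : hR :=
  rho (word_prod (rev (drop j.+1 b))) *m simple_root (tnth (in_tuple b) j).

End CoinvariantAlgebra.

(* Main.v *)
Require Import Defs.
From mathcomp Require Import all_boot all_order all_fingroup all_algebra.
From mathcomp Require Import generic_quotient ring_quotient mxrepresentation.
From mathcomp Require Import mpoly complex.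
From mathcomp Require Import boolp classical_sets reals trigo.
From mathcomp Require Import cyclic zify ring.

Import Order.TTheory GRing.Theory Num.Theory.

(** For a word b = (i_1, ..., i_k) and v in W, let D(b, v) be the sum, over the
    reduced subwords of b for v, of the composites having s_(i_j) at the letters
    of the subword and the divided difference at the others.  If c is a reduced
    word of w, the left-hand side is v^-1 D(c, v).  On the right-hand side, put
    u = w_o v.  Since alpha_j = s_l ... s_(j+1)(beta_j) and s_beta d_beta = d_beta,
    pulling u = s_1 ... s_l from the left through the composite of the
    d_(alpha_j), j in J, replaces it by the composite having d_(beta_j) for j
    in J and s_(beta_j) for j outside J ([word_root_sum]).  So the right-hand
    side is u^-1 D(b, w_o w), and the theorem becomes the duality
<<
      D(c, v) = w_o D(b, w_o w),
>>
    which already holds on S(h) ([skew_duality]).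

    The duality is an induction on the length of w = w' s.  Splitting off the
    last letter gives D(c' s, v) = D(c', v) d + [vs < v] D(c', vs) s.  Put
    x = w_o v and y = w_o w', so that ys < y.  If xs > x, the formula to be
    proved is that same recursion for the word of xs ending in s, multiplied by
    s on the right, with d s = - d.  If xs < x, the word of x may be chosen to
    end in s, and the formula follows from d d = 0 and s d = d.

    This uses that D(b, v), for b reduced, depends only on the product of b.
    The D(b, v) are the coordinates of the product of the operators
    s_i (x) T_i + d_i (x) 1, where the T_i generate the nilCoxeter algebra of
    W, so by Matsumoto's theorem ([matsumoto]) it is enough to check the braid
    relations for these operators ([tensor_braid]).  Move a linear form to the
    left through the alternating product of length m: Leibniz' rule produces one
    term per deleted letter, and only the two end letters survive, an inner
    deletion creating a square, which vanishes.  What survives on the two sides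
    of the braid relation agrees by a computation with sines in the dihedral
    group ([dihedral_root]).  Hence both sides agree on all polynomials as soon
    as they do on scalars, where they are products of the T_i.

    The combinatorics of W comes from the exchange condition ([exchange]), which
    follows from the presentation through a signed permutation action on W. *)

(** * Words and length *)

Section CoxeterCombinatorics.
Local Open Scope group_scope.
Set Implicit Arguments.
Unset Strict Implicit.

Variable W : finCoxeterSystem.
Notation I := 'I_(cox_rank W).
Notation s := (@simple_refl W).
Notation len := (@cox_length W).
Notation wp := (@word_prod W).
Implicit Types (i j : I) (b c : seq I) (u v w t : W).

Lemma simple_mulss i : s i * s i = 1.
Proof. by have := expg_order (s i); rewrite simple_order expgS expg1. Qed.

Lemma simpleK i : involutive (mulg (s i)).
Proof. by move=> w; rewrite mulgA simple_mulss mul1g. Qed.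

Lemma simpleKr i w : w * s i * s i = w.
Proof. by rewrite -mulgA simple_mulss mulg1. Qed.

Lemma simpleV i : (s i)^-1 = s i.
Proof. by apply: (mulgI (s i)); rewrite mulgV simple_mulss. Qed.

Lemma simple_conj i : s i ^ s i = s i.
Proof. by rewrite conjgE simple_mulss mulg1 simpleV. Qed.

Lemma word_prod_nil : wp [::] = 1.
Proof. by rewrite /word_prod big_nil. Qed.

Lemma word_prod_cons i b : wp (i :: b) = s i * wp b.
Proof. by rewrite /word_prod big_cons. Qed.

Lemma word_prod_cat b c : wp (b ++ c) = wp b * wp c.
Proof. by rewrite /word_prod big_cat. Qed.

Lemma word_prod_rcons b i : wp (rcons b i) = wp b * s i.
Proof. by rewrite -cats1 word_prod_cat word_prod_cons word_prod_nil mulg1. Qed.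

Lemma word_prod_rev b : wp (rev b) = (wp b)^-1.
Proof.
elim: b => [|i b IHb]; first by rewrite word_prod_nil invg1.
by rewrite rev_cons word_prod_rcons word_prod_cons IHb invMg simpleV.
Qed.

Lemma cox_length_word b : len (wp b) <= size b.
Proof.
rewrite /cox_length; case: ex_minnP => k _; apply.
by apply/existsP; exists (in_tuple b).
Qed.

Lemma reduced_wordP w : reduced_expr (reduced_word w) w.
Proof.
rewrite /reduced_expr /reduced_word size_tuple eqxx andbT.
exact: xchooseP (reduced_word_exists w).
Qed.

Lemma reduced_exprP b w : reduced_expr b w -> wp b = w /\ size b = len w.
Proof. by case/andP=> /eqP -> /eqP ->. Qed.

Lemma cox_length1 : len 1 = 0.
Proof. by apply/eqP; rewrite -leqn0 -word_prod_nil (cox_length_word [::]). Qed.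

Lemma cox_length_eq0 w : len w = 0 -> w = 1.
Proof.
have [ew <-] := reduced_exprP (reduced_wordP w).
by move/size0nil=> w0; rewrite -ew w0 word_prod_nil.
Qed.

Lemma cox_lengthV w : len w^-1 = len w.
Proof.
have leV u : len u^-1 <= len u.
  have [eu <-] := reduced_exprP (reduced_wordP u).
  by rewrite -{1}eu -word_prod_rev -[X in _ <= X]size_rev cox_length_word.
by apply/eqP; rewrite eqn_leq leV -{1}(invgK w) leV.
Qed.

Lemma cox_lengthM u v : len (u * v) <= len u + len v.
Proof.
have [eu <-] := reduced_exprP (reduced_wordP u).
have [ev <-] := reduced_exprP (reduced_wordP v).
by rewrite -{1}eu -{1}ev -word_prod_cat -size_cat cox_length_word.
Qed.

(** The sign character: every generator may be sent to one transposition, as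
    the square of a transposition is trivial. *)
Lemma odd_size_word b c : wp b = wp c -> odd (size b) = odd (size c).
Proof.
have [//|phi [phiM phi_s]] :=
  @simple_presentation W {perm bool} (fun _ => tperm true false).
  by move=> i j; rewrite tperm2 expg1n.
have phi1 : phi 1 = 1 by apply: (mulgI (phi 1)); rewrite -phiM !mulg1.
have phiE d : phi (wp d) true = ~~ odd (size d).
  elim/last_ind: d => [|d i IHd]; first by rewrite word_prod_nil phi1 perm1.
  rewrite word_prod_rcons phiM permM IHd phi_s size_rcons /=.
  by case: (odd _); rewrite /= ?tpermL ?tpermR.
by move=> eq_bc; apply: negb_inj; rewrite -!phiE eq_bc.
Qed.

Lemma odd_cox_length b : odd (len (wp b)) = odd (size b).
Proof.
have [e <-] := reduced_exprP (reduced_wordP (wp b)).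
exact: odd_size_word.
Qed.

Lemma odd_cox_lengthM u v : odd (len (u * v)) = odd (len u) (+) odd (len v).
Proof.
have [eu <-] := reduced_exprP (reduced_wordP u).
have [ev <-] := reduced_exprP (reduced_wordP v).
by rewrite -{1}eu -{1}ev -word_prod_cat odd_cox_length size_cat oddD.
Qed.

Lemma cox_length_simple i : len (s i) = 1%N.
Proof.
have := odd_cox_length [:: i]; have := cox_length_word [:: i].
by rewrite word_prod_cons word_prod_nil mulg1 /=; case: (len _) => [|[]].
Qed.

Variant left_mul_spec i w : bool -> Type :=
| LeftDown of len w = (len (s i * w)).+1 : left_mul_spec i w true
| LeftUp of len (s i * w) = (len w).+1 : left_mul_spec i w false.

Lemma cox_length_left i w : left_mul_spec i w (len (s i * w) < len w).
Proof.
have := odd_cox_lengthM (s i) w.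
have := cox_lengthM (s i) w; have := cox_lengthM (s i) (s i * w).
rewrite simpleK cox_length_simple => le1 le2 odd_l.
by case: (ltnP (len (s i * w)) (len w)) => lt; constructor; lia.
Qed.

Variant right_mul_spec i w : bool -> Type :=
| RightDown of len w = (len (w * s i)).+1 : right_mul_spec i w true
| RightUp of len (w * s i) = (len w).+1 : right_mul_spec i w false.

Lemma cox_length_right i w : right_mul_spec i w (len (w * s i) < len w).
Proof.
have eq_l : len (s i * w^-1) = len (w * s i).
  by rewrite -cox_lengthV invMg invgK simpleV.
have := cox_length_left i w^-1; rewrite eq_l cox_lengthV.
by case; rewrite eq_l cox_lengthV; constructor.
Qed.

Lemma reduced_expr_cons i b w :
  reduced_expr (i :: b) w = reduced_expr b (s i * w) && (len (s i * w) < len w).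
Proof.
rewrite /reduced_expr word_prod_cons /= (can2_eq (simpleK i) (simpleK i)).
case: eqP => //= eb; have := cox_length_word b; rewrite eb.
by case: cox_length_left => ->; lia.
Qed.

Lemma reduced_expr_nil w : reduced_expr [::] w = (w == 1).
Proof.
rewrite /reduced_expr word_prod_nil eq_sym.
by case: eqP => // ->; rewrite cox_length1.
Qed.

Lemma reduced_expr_rcons b i w :
  reduced_expr (rcons b i) w = reduced_expr b (w * s i) && (len (w * s i) < len w).
Proof.
rewrite /reduced_expr word_prod_rcons size_rcons -{1}(simpleV i) divg_eq.
case: eqP => //= eb; have := cox_length_word b; rewrite eb.
by case: cox_length_right => ->; lia.
Qed.

Lemma order_simpleC i j : #[s i * s j] = #[s j * s i].
Proof. by rewrite -[RHS]orderV invMg !simpleV. Qed.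

(** * The exchange condition *)

(** The action of W on signed reflections, extended to all of W with signs: the
    generator [s i] conjugates and changes the sign at its own reflection only.
    The sign picked up by t along a word counts modulo 2 how often t occurs
    among the reflections of that word, and by the presentation of W this
    parity depends only on the product of the word. *)
Definition simple_perm_fun i (p : W * bool) : W * bool :=
  (p.1 ^ s i, p.2 (+) (p.1 == s i)).

Lemma simple_perm_funK i : involutive (simple_perm_fun i).
Proof.
case=> t e; rewrite /simple_perm_fun /= -conjgM simple_mulss conjg1.
by rewrite -{3}(simple_conj i) (inj_eq (conjg_inj (s i))) addbK.
Qed.

Definition simple_perm i : {perm W * bool} :=
  perm (inv_inj (@simple_perm_funK i)).

Lemma simple_rotV i j k : s i * ((s i * s j) ^+ k)^-1 = (s i * s j) ^+ k * s i.
Proof.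
have zV : (s i * s j)^-1 = (s i * s j) ^ s i.
  by rewrite invMg conjgE !simpleV -!mulgA simpleK.
by rewrite -expgVn zV -conjXg conjgE simpleV simpleK.
Qed.

Lemma simple_rot_conj i j k t :
  (t ^ ((s i * s j) ^+ k) == s i) = (t * s i == (s i * s j) ^+ k.*2).
Proof.
rewrite -(inj_eq (conjg_inj ((s i * s j) ^+ k)^-1)) conjgK.
rewrite -(inj_eq (mulIg (s i))) conjgE invgK simple_rotV -addnn expgD.
by rewrite mulgA simpleKr.
Qed.

Lemma simple_rot_conjS i j k t :
  ((t ^ ((s i * s j) ^+ k)) ^ s i == s j) = (t * s i == (s i * s j) ^+ k.*2.+1).
Proof.
rewrite -(inj_eq (conjg_inj (s i))) -conjgM simple_mulss conjg1.
rewrite -(inj_eq (conjg_inj ((s i * s j) ^+ k)^-1)) conjgK.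
rewrite -(inj_eq (mulIg (s i))) !conjgE invgK simpleV -!mulgA.
rewrite [s i * (_^-1 * _)]mulgA simple_rotV !mulgA !simpleKr.
by rewrite -(mulgA _ (s i) (s j)) -expgSr -expgD addSn addnn.
Qed.

(** Along (s i s j)^k the reflections met are (s i s j)^l (s i) for l < 2 k. *)
Lemma simple_perm_rot i j k t e :
  ((simple_perm i * simple_perm j) ^+ k) (t, e) =
  (t ^ ((s i * s j) ^+ k),
   e (+) odd (\sum_(l < k.*2) (t * s i == (s i * s j) ^+ l)%g)).
Proof.
elim: k => [|k IHk]; first by rewrite perm1 conjg1 big_ord0 addbF.
rewrite expgSr permM IHk permM !permE /simple_perm_fun /=; congr (_, _).
  by rewrite -!conjgM -expgSr.
rewrite doubleS !big_ord_recr /= simple_rot_conj simple_rot_conjS.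
by rewrite !oddD !oddb !addbA.
Qed.

(** The powers of [s i * s j] have period m, so that over 2 m letters each
    reflection is met an even number of times. *)
Lemma simple_perm_braid i j :
  (simple_perm i * simple_perm j) ^+ #[s i * s j] = 1.
Proof.
apply/permP=> -[t e]; rewrite simple_perm_rot perm1 expg_order conjg1.
congr (_, _); rewrite -addnn big_split_ord /= [X in (_ + X)%N](eq_bigr
  (fun l : 'I__ => nat_of_bool (t * s i == (s i * s j) ^+ l))).
  by rewrite addnn odd_double addbF.
by move=> l _; rewrite expgD expg_order mul1g.
Qed.

Fixpoint inversion_parity b t : bool :=
  if b is i :: c then (t == s i) (+) inversion_parity c (t ^ s i) else false.

Lemma inversion_parity_word b c t :
  wp b = wp c -> inversion_parity b t = inversion_parity c t.
Proof.
have [phi [phiM phi_s]] := simple_presentation simple_perm_braid.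
have phi1 : phi 1 = 1 by apply: (mulgI (phi 1)); rewrite -phiM !mulg1.
have phiE d : forall r e,
    phi (wp d) (r, e) = (r ^ wp d, e (+) inversion_parity d r).
  elim: d => [|i d IHd] r e; first by rewrite word_prod_nil phi1 perm1 conjg1 addbF.
  rewrite word_prod_cons phiM permM phi_s permE IHd /=.
  by rewrite conjgM addbA.
move=> eq_bc; have := phiE b t false; rewrite eq_bc phiE.
by case.
Qed.

(** An odd parity means that t is one of the reflections of the word b.  If
    b = (i_1, ..., i_k) and t = s_1 ... s_p ... s_1, then t times the product
    of b is the product of b without its p-th letter. *)
Lemma inversion_deletion b t : inversion_parity b t ->
  exists2 k, k < size b & t * wp b = wp (take k b ++ drop k.+1 b).
Proof.
elim: b t => //= i b IHb t.
have [-> _|_ /= /IHb[k lt_k eq_k]] := eqVneq t (s i).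
  by exists 0; rewrite //= drop0 word_prod_cons simpleK.
exists k.+1 => //=; rewrite !word_prod_cons -eq_k.
by rewrite conjgE simpleV !mulgA simple_mulss mul1g.
Qed.

(** As the parity may be computed on any word with the same product, take a
    word starting with i whose tail c is reduced.  There the reflection [s i] is
    met at the first letter, and not again: otherwise one letter of c could be
    deleted after multiplying by [s i], against the length drop. *)
Lemma exchange i b : len (s i * wp b) < len (wp b) ->
  exists2 k, k < size b & s i * wp b = wp (take k b ++ drop k.+1 b).
Proof.
move=> down; apply: inversion_deletion.
have [c_eq c_size] := reduced_exprP (reduced_wordP (s i * wp b)).
set c := reduced_word _ in c_eq c_size.
rewrite (@inversion_parity_word _ (i :: c)); last first.
  by rewrite word_prod_cons c_eq simpleK.
rewrite /= eqxx simple_conj; apply/negP => /inversion_deletion[k lt_k].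
rewrite c_eq simpleK => eb.
have := cox_length_word (take k c ++ drop k.+1 c); rewrite -eb.
by rewrite size_cat size_take size_drop lt_k; lia.
Qed.

Lemma exchange_cat i b c : len (s i * wp (b ++ c)) < len (wp (b ++ c)) ->
  (exists2 k, k < size b & s i * wp b = wp (take k b ++ drop k.+1 b)) \/
  (exists2 c', size c = (size c').+1 & s i * wp (b ++ c) = wp (b ++ c')).
Proof.
move/exchange=> [k]; rewrite size_cat take_cat drop_cat => lt_k.
have [lt_kb|le_bk] := ltnP k (size b).
  have -> : (if k.+1 < size b then drop k.+1 b ++ c else drop (k.+1 - size b) c)
    = drop k.+1 b ++ c.
    case: ltnP => // le_bk; have -> : k.+1 = size b by lia.
    by rewrite subnn drop0 drop_size.
  rewrite catA !word_prod_cat !mulgA => /mulIg eb; left; exists k => //.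
  by rewrite eb word_prod_cat.
rewrite ltnNge (leq_trans le_bk) // -catA => eb; right.
exists (take (k - size b) c ++ drop (k.+1 - size b) c) => //.
by rewrite size_cat size_take size_drop; case: ifP; lia.
Qed.

(** * The longest element *)

Lemma leq_cox_length_longest w : len w <= len (longest_elt W).
Proof. by rewrite /longest_elt; case: arg_maxnP => // x _; apply. Qed.

(** Every reduced word b can be completed to a reduced word of the longest
    element.  To add a letter i in front of b, apply the exchange condition to
    a completed word b c: as i b is reduced, the deleted letter lies in c. *)
Lemma cox_length_longestVM v :
  len v + len (v^-1 * longest_elt W) = len (longest_elt W).
Proof.
set w0 := longest_elt W.
suff main b : size b = len (wp b) -> len (wp b) + len ((wp b)^-1 * w0) = len w0.
  have [ev lv] := reduced_exprP (reduced_wordP v).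
  by move: (main (reduced_word v)); rewrite ev; apply.
elim: b => [|i b IHb] lv; first by rewrite word_prod_nil invg1 mul1g cox_length1.
have lb : size b = len (wp b).
  move: lv (cox_length_word b); rewrite word_prod_cons /=.
  by case: (cox_length_left i (wp b)); lia.
have [c_eq c_size] := reduced_exprP (reduced_wordP ((wp b)^-1 * w0)).
set c := reduced_word _ in c_eq c_size.
have w0E : wp (b ++ c) = w0 by rewrite word_prod_cat c_eq mulKVg.
have down : len (s i * w0) < len w0.
  case: cox_length_left => // up.
  by have := leq_cox_length_longest (s i * w0); rewrite up ltnn.
have [|[k lt_k eb]|[c' sz_c']] := @exchange_cat i b c; rewrite ?w0E //.
  have := cox_length_word (take k b ++ drop k.+1 b).
  rewrite -eb -word_prod_cons -lv size_cat size_take size_drop lt_k /=; lia.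
have := IHb lb; rewrite -c_size sz_c' => lw0 eb.
have le_c' : len ((wp (i :: b))^-1 * w0) <= size c'.
  rewrite word_prod_cons invMg simpleV -mulgA eb word_prod_cat mulKg.
  exact: cox_length_word.
have := cox_lengthM (wp (i :: b)) ((wp (i :: b))^-1 * w0).
rewrite mulKVg -lv /= -/w0; lia.
Qed.

(** Additivity of lengths for v = w_o^-1 leaves length 0 for w_o w_o. *)
Lemma longest_mulss : longest_elt W * longest_elt W = 1.
Proof.
apply: cox_length_eq0; have := cox_length_longestVM (longest_elt W)^-1.
by rewrite invgK cox_lengthV -[RHS]addn0 => /addnI.
Qed.

Lemma longestV : (longest_elt W)^-1 = longest_elt W.
Proof. by apply: (mulgI (longest_elt W)); rewrite mulgV longest_mulss. Qed.

Lemma cox_length_longestM v : len v + len (longest_elt W * v) = len (longest_elt W).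
Proof.
by rewrite -[in RHS](cox_length_longestVM v) -(cox_lengthV (_ * v)) invMg longestV.
Qed.

Lemma cox_length_longest_lt u v :
  (len (longest_elt W * u) < len (longest_elt W * v)) = (len v < len u).
Proof.
by have := cox_length_longestM u; have := cox_length_longestM v; lia.
Qed.

(** * Braid moves connect the reduced words of an element *)

Fixpoint alt i j k : seq I := if k is k'.+1 then i :: alt j i k' else [::].

Lemma size_alt i j k : size (alt i j k) = k.
Proof. by elim: k i j => //= k IHk i j; rewrite IHk. Qed.

Lemma alt_rcons i j k : alt i j k.+1 = rcons (alt i j k) (if odd k then j else i).
Proof.
elim: k i j => // k IHk i j.
by rewrite [LHS]/= -/(alt j i k.+1) IHk /= if_neg.
Qed.

Lemma expg_swap u v k : u * (v * u) ^+ k = (u * v) ^+ k * u.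
Proof.
elim: k => [|k IHk]; first by rewrite mulg1 mul1g.
by rewrite expgSr [in RHS]expgSr mulgA IHk -!mulgA.
Qed.

Lemma word_prod_alt_quotient i j k :
  wp (alt i j k) * (wp (alt j i k))^-1 = (s i * s j) ^+ k.
Proof.
elim: k i j => [|k IHk] i j; first by rewrite /= word_prod_nil mulgV.
rewrite /= !word_prod_cons invMg simpleV mulgA -(mulgA (s i)) IHk.
by rewrite expg_swap -mulgA -expgSr.
Qed.

Lemma word_prod_alt_braid i j :
  wp (alt i j #[s i * s j]) = wp (alt j i #[s i * s j]).
Proof.
apply: (mulIg (wp (alt j i #[s i * s j]))^-1).
by rewrite word_prod_alt_quotient mulgV expg_order.
Qed.

(** The p-th reflection of the word j i j ... is an odd alternating product, so
    that deleting the letter p amounts to multiplying by it. *)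
Lemma word_prod_alt_delete i j k p : p < k ->
  wp (take p (alt j i k) ++ drop p.+1 (alt j i k)) =
  s i * ((s i * s j) ^+ p.+1 * wp (alt j i k)).
Proof.
elim: p i j k => [|p IHp] i j [|k] //.
  by move=> _; rewrite /= drop0 word_prod_cons expg1 -(mulgA (s i)) !simpleK.
rewrite ltnS => /(IHp j i) IH; rewrite /= !word_prod_cons IH simpleK.
by rewrite [in RHS]expgS !mulgA simple_mulss mul1g expg_swap simpleKr.
Qed.

Lemma simple_rot_gt1 i j : i != j -> 1 < #[s i * s j].
Proof.
move=> ne_ij; rewrite ltnNge; apply/negP => le1.
have/eqP : #[s i * s j] = 1%N by apply/eqP; rewrite eqn_leq le1 order_gt0.
rewrite order_eq1 => /eqP e; case/eqP: ne_ij; apply: simple_inj.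
by apply: (mulIg (s j)); rewrite e simple_mulss.
Qed.

(** By induction there is a reduced word starting with j i j ... (k letters).
    Exchange for i deletes one of its letters.  A deletion among the first k
    letters would give (s i s j)^p = 1 with 0 < p <= k, which is impossible for
    k smaller than the order m. *)
Lemma two_left_descents i j k w :
    len (s i * w) < len w -> len (s j * w) < len w -> k <= #[s i * s j] ->
  exists c, reduced_expr (alt i j k ++ c) w.
Proof.
elim: k i j => [|k IHk] i j dn_i dn_j le_k.
  by exists (reduced_word w); exact: reduced_wordP.
have [|c red_c] := IHk j i dn_j dn_i.
  by rewrite -orderV invMg !simpleV ltnW.
have [c_eq c_size] := reduced_exprP red_c.
have [|[p]|[c' sz_c']] := @exchange_cat i (alt j i k) c; rewrite ?c_eq //.
  rewrite size_alt => lt_pk; rewrite (word_prod_alt_delete i j lt_pk).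
  move/mulgI/esym/(canRL (mulgK _))/eqP; rewrite mulgV -order_dvdn.
  by move/dvdn_leq => /(_ isT); lia.
move=> ew; exists c'; apply/andP; split.
  by rewrite /= word_prod_cons -ew simpleK.
by rewrite -c_size /= !size_cat !size_alt sz_c' addnS.
Qed.

(** If two reduced words of w start with distinct letters i and j, both are
    connected to words starting with the two alternating words of length m in i
    and j, followed by the same tail; the tails behind the first letter are
    compared by induction. *)
Lemma matsumoto (X : Type) (Theta : I -> X -> X) (x : X) :
    (forall i j y, i != j ->
       foldr Theta y (alt i j #[s i * s j]) = foldr Theta y (alt j i #[s i * s j])) ->
  forall b c w, reduced_expr b w -> reduced_expr c w ->
  foldr Theta x b = foldr Theta x c.
Proof.
move=> braid b c w red_b.
have [n] := ubnP (size b); elim: n b c w red_b => // n IHn.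
move=> [|i b] [|j c] w //; rewrite ltnS.
- by move=> /reduced_exprP[_ sz] _ /reduced_exprP[_]; rewrite -sz.
- by move=> /reduced_exprP[_ sz] _ /reduced_exprP[_]; rewrite -sz.
move=> red_ib lt_b red_jc.
have [e|ne_ij] := eqVneq i j.
  rewrite -{j}e in red_jc *; rewrite /=; congr (Theta i _).
  move: red_ib red_jc; rewrite !reduced_expr_cons => /andP[red_b _] /andP[red_c _].
  exact: IHn red_b lt_b red_c.
have dn_i : len (s i * w) < len w by move: red_ib; rewrite reduced_expr_cons => /andP[].
have dn_j : len (s j * w) < len w by move: red_jc; rewrite reduced_expr_cons => /andP[].
have [d red_d] := two_left_descents dn_i dn_j (leqnn _).
have m_gt0 : 0 < #[s i * s j] := order_gt0 _.
have red_d' : reduced_expr (alt j i #[s i * s j] ++ d) w.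
  move: red_d.
  by rewrite /reduced_expr !word_prod_cat word_prod_alt_braid !size_cat !size_alt.
have step k a e : reduced_expr (k :: a) w -> size a < n -> reduced_expr (k :: e) w ->
   foldr Theta x (k :: a) = foldr Theta x (k :: e).
  rewrite !reduced_expr_cons => /andP[red_a _] lt_a /andP[red_e _] /=.
  by rewrite (IHn _ _ _ red_a lt_a red_e).
have lt_c : size c < n.
  have [_ szc] := reduced_exprP red_jc; have [_ szb] := reduced_exprP red_ib.
  by move: szc szb lt_b => /=; lia.
have := braid i j (foldr Theta x d) ne_ij; rewrite -!foldr_cat.
case: #[s i * s j] m_gt0 red_d red_d' => // m _ red_d red_d' e.
by rewrite (step _ _ _ red_ib lt_b red_d) e -(step _ _ _ red_jc lt_c red_d').
Qed.

End CoxeterCombinatorics.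

(** * Skew operators of words and their duality *)

(** The duality only uses the following formal properties of the actions of W
    and of the simple divided differences [D i] on a commutative ring. *)
Section SkewOperators.
Set Implicit Arguments.
Unset Strict Implicit.

Variables (W : finCoxeterSystem) (A : comPzRingType).
Notation I := 'I_(cox_rank W).
Notation s := (@simple_refl W).
Notation len := (@cox_length W).
Notation wp := (@word_prod W).
Notation w0 := (longest_elt W).
Implicit Types (i j : I) (b c : seq I) (u v w : W) (f g a : A).
Local Open Scope ring_scope.

Variables (act : W -> A -> A) (D : I -> A -> A).
Hypothesis actD : forall u, {morph act u : f g / f + g}.
Hypothesis actM : forall u, {morph act u : f g / f * g}.
Hypothesis act1 : forall f, act 1%g f = f.
Hypothesis act_comp : forall u v f, act (u * v)%g f = act u (act v f).
Hypothesis DD : forall i, {morph D i : f g / f + g}.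
Hypothesis DM : forall i f g, D i (f * g) = D i f * g + act (s i) f * D i g.
Hypothesis sD : forall i f, act (s i) (D i f) = D i f.
Hypothesis Ds : forall i f, D i (act (s i) f) = - D i f.
Hypothesis Dsq : forall i f, D i (D i f) = 0.

Let act0 u : act u 0 = 0.
Proof. by apply: (addrI (act u 0)); rewrite -actD !addr0. Qed.

Let Dzero i : D i 0 = 0.
Proof. by apply: (addrI (D i 0)); rewrite -DD !addr0. Qed.

Let actK i f : act (s i) (act (s i) f) = f.
Proof. by rewrite -act_comp simple_mulss act1. Qed.

Notation WA := {ffun W -> A}.

(** A function F stands for the element of A (x) N with coordinates F v in the
    basis T_v of the nilCoxeter algebra N of W, in which T_i T_v is T_(s_i v) if
    s_i v is longer than v, and 0 otherwise.  This is s_i (x) T_i + D_i (x) 1. *)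
Definition tensor_op i (F : WA) : WA :=
  [ffun v => D i (F v) +
     if (len (s i * v)%g < len v)%N then act (s i) (F (s i * v)%g) else 0].

Notation T := tensor_op.
Notation Tw b F := (foldr tensor_op F b).

Definition scale f (F : WA) : WA := [ffun v => f * F v].

Definition single v f : WA := [ffun u => if u == v then f else 0].

Lemma tensor_opD i : {morph T i : F G / F + G}.
Proof.
move=> F G; apply/ffunP=> v; rewrite !ffunE DD.
by case: ifP => _; rewrite ?actD ?addr0 // addrACA.
Qed.

Lemma tensor_wordD b : {morph (fun F => Tw b F) : F G / F + G}.
Proof. by elim: b => //= i b IHb F G; rewrite IHb tensor_opD. Qed.

(** The tensor operators obey the same twisted Leibniz rule as the [D i] with
    respect to multiplication of the first tensor factor. *)
Lemma tensor_opM i f F :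
  T i (scale f F) = scale (act (s i) f) (T i F) + scale (D i f) F.
Proof.
apply/ffunP=> v; rewrite !ffunE DM; case: ifP => _; rewrite ?actM ?addr0.
  by rewrite mulrDr [RHS]addrC addrA.
by rewrite addrC.
Qed.

(** T_i^2 = 0 and D_i D_i = 0, while the mixed terms cancel: D_i s_i = - D_i
    and s_i D_i = D_i. *)
Lemma tensor_op_sq i F : T i (T i F) = 0.
Proof.
apply/ffunP=> v; rewrite !ffunE simpleK DD Dsq add0r.
case: cox_length_left => lv; last by rewrite Dzero addr0.
rewrite Ds ltnNge lv leqnSn addr0 sD addNr //.
Qed.

Definition invariant_const a := (forall u, act u a = a) /\ (forall i, D i a = 0).

Lemma tensor_op_const i a F : invariant_const a -> T i (scale a F) = scale a (T i F).
Proof.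
case=> act_a D_a; rewrite tensor_opM act_a D_a; apply/ffunP=> v.
by rewrite !ffunE mul0r addr0.
Qed.

(** On scalars only the T_i act, and T_b T_u is T_(b u) if the lengths add up
    and 0 otherwise; this depends on b only through its product and size. *)
Lemma tensor_word_const b (F : WA) v : (forall u, invariant_const (F u)) ->
  Tw b F v =
  if (len ((wp b)^-1 * v)%g + size b == len v)%N then F ((wp b)^-1 * v)%g else 0.
Proof.
move=> constF; elim: b v => [|i b IHb] v.
  by rewrite word_prod_nil invg1 mul1g addn0 eqxx.
have const0 : invariant_const 0 by split.
have constb u : invariant_const (Tw b F u) by rewrite IHb; case: ifP.
rewrite [LHS]ffunE (constb v).2 add0r (constb _).1 IHb word_prod_cons invMg simpleV.
rewrite mulgA; set u := (_ * _ * v)%g.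
have le_su : (len (s i * v)%g <= size b + len u)%N.
  rewrite (_ : (s i * v = wp b * u)%g); last by rewrite /u !mulgA mulgV mul1g.
  by rewrite (leq_trans (cox_lengthM _ _)) // leq_add2r cox_length_word.
case: cox_length_left => lv /=; first by rewrite lv addnS eqSS.
by case: eqP => // eu; move: le_su eu; rewrite lv; lia.
Qed.

Lemma scale0 f : scale f 0 = 0.
Proof. by apply/ffunP=> v; rewrite !ffunE mulr0. Qed.

Variables (X : Type) (lin : X -> A).
Hypothesis D_lin : forall i u x, invariant_const (D i (act u (lin x))).

(** Move a linear form through an alternating word.  Deleting an inner letter
    makes two equal letters adjacent, so only the deletions of the first and of
    the last letter contribute. *)
Lemma tensor_alt_lin i j k x F :
  Tw (alt i j k.+2) (scale (lin x) F) =
    scale (act (wp (alt i j k.+2)) (lin x)) (Tw (alt i j k.+2) F)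
    + scale (D i (act (wp (alt j i k.+1)) (lin x))) (Tw (alt j i k.+1) F)
    + scale (D (if odd k.+1 then j else i) (lin x)) (Tw (alt i j k.+1) F).
Proof.
have D_lin1 i' : invariant_const (D i' (lin x)).
  by have := D_lin i' 1%g x; rewrite act1.
elim: k i j => [|k IHk] i j.
  rewrite /= !word_prod_cons word_prod_nil mulg1 tensor_opM tensor_opD tensor_opM.
  by rewrite tensor_op_const // -act_comp.
have TwS i' j' l G : Tw (alt i' j' l.+1) G = T i' (Tw (alt j' i' l) G) by [].
rewrite TwS IHk !tensor_opD tensor_opM !tensor_op_const // -act_comp -word_prod_cons.
rewrite (TwS i j k) tensor_op_sq scale0 addr0.
by rewrite [odd k.+2]/= if_neg.
Qed.

(** In terms of roots: the alternating product of length m - 1 maps one simple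
    root of a dihedral group of order 2 m to a simple root. *)
Hypothesis dihedral : forall i j x, i != j ->
  let m := #[(s i * s j)%g]%g in
  D i (act (wp (alt j i m.-1)) (lin x)) = D (if odd m.-1 then i else j) (lin x).

Hypothesis lin_generate : forall P : A -> Prop,
  (forall a, invariant_const a -> P a) -> (forall x f, P f -> P (lin x * f)) ->
  (forall f g, P f -> P g -> P (f + g)) -> forall f, P f.

Lemma singleD v : {morph single v : f g / f + g}.
Proof. by move=> f g; apply/ffunP=> u; rewrite !ffunE; case: ifP; rewrite ?addr0. Qed.

Lemma ffun_single_sum (F : WA) : F = \sum_v single v (F v).
Proof.
apply/ffunP=> u; rewrite sum_ffunE (bigD1 u) //= ffunE eqxx big1 ?addr0 // => v ne_vu.
by rewrite ffunE eq_sym (negPf ne_vu).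
Qed.

(** Both sides commute in the same way with multiplication by a linear form, up
    to terms that agree: deleting the first letter on one side leaves the same
    word as deleting the last letter on the other side, and the coefficients
    agree by the dihedral hypothesis.  So the relation extends from scalars to
    all of A. *)
Lemma tensor_braid i j (F : WA) : i != j ->
  Tw (alt i j #[(s i * s j)%g]%g) F = Tw (alt j i #[(s i * s j)%g]%g) F.
Proof.
move=> ne_ij; set m := #[_]%g.
pose P F := Tw (alt i j m) F = Tw (alt j i m) F.
have PD F1 F2 : P F1 -> P F2 -> P (F1 + F2) by rewrite /P !tensor_wordD => -> ->.
have Pconst (F1 : WA) : (forall u, invariant_const (F1 u)) -> P F1.
  move=> constF; apply/ffunP=> v; rewrite !tensor_word_const //.
  by rewrite word_prod_alt_braid !size_alt.
have const0 : invariant_const 0 by split.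
have Plin x F1 : P F1 -> P (scale (lin x) F1).
  have [k mE] : exists k, m = k.+2.
    by have := simple_rot_gt1 ne_ij; rewrite -/m; case: (m) => [|[|k]] // _; exists k.
  have := dihedral x ne_ij; rewrite eq_sym in ne_ij; have := dihedral x ne_ij.
  have := word_prod_alt_braid i j.
  rewrite /= (order_simpleC j i) -/m /P mE => eq_w dih_j dih_i eqF.
  rewrite !tensor_alt_lin eqF eq_w dih_i dih_j -!addrA; congr (_ + _).
  by rewrite addrC; case: (odd _).
suff: P F by [].
rewrite [F]ffun_single_sum; elim/big_ind: _ => [||v _]; [|exact: PD|].
  by apply: Pconst => u; rewrite ffunE.
elim/lin_generate: (F v) => [a const_a|x f Pf|f g Pf Pg].
- by apply: Pconst => u; rewrite ffunE; case: ifP.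
- have -> : single v (lin x * f) = scale (lin x) (single v f); last exact: Plin.
  by apply/ffunP=> u; rewrite !ffunE; case: ifP; rewrite ?mulr0.
- by rewrite singleD; apply: PD.
Qed.

(** The value at f of the sum, over the reduced subwords of b for v, of the
    composites having [act (s i)] at the letters of the subword and [D i] at the
    other letters. *)
Definition skew b v f : A := Tw b (single 1%g f) v.

Lemma skew_nil v f : skew [::] v f = if v == 1%g then f else 0.
Proof. by rewrite /skew ffunE. Qed.

Lemma skew_cons i b v f : skew (i :: b) v f = D i (skew b v f) +
  if (len (s i * v)%g < len v)%N then act (s i) (skew b (s i * v)%g f) else 0.
Proof. by rewrite /skew /= ffunE. Qed.

Lemma skew_reduced b c w v f : reduced_expr b w -> reduced_expr c w ->
  skew b v f = skew c v f.
Proof.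
move=> red_b red_c; rewrite /skew (matsumoto _ _ red_b red_c) // => i j F.
exact: tensor_braid.
Qed.

Lemma skewD b v : {morph skew b v : f g / f + g}.
Proof. by move=> f g; rewrite /skew singleD tensor_wordD ffunE. Qed.

Lemma skew0 b v : skew b v 0 = 0.
Proof. by apply: (addrI (skew b v 0)); rewrite -skewD !addr0. Qed.

Lemma skewN b v f : skew b v (- f) = - skew b v f.
Proof. by apply: (addrI (skew b v f)); rewrite -skewD !subrr skew0. Qed.

(** The recursion at the first letter defines [skew]; the two recursions
    commute because lengths change by one at each multiplication by a generator,
    so that both orders of two descents are detected by a total drop of 2. *)
Lemma skew_rcons b i v f : skew (rcons b i) v f = skew b v (D i f) +
  if (len (v * s i)%g < len v)%N then skew b (v * s i)%g (act (s i) f) else 0.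
Proof.
elim: b v => [|j b IHb] v.
  rewrite skew_cons !skew_nil.
  have -> : (v * s i == 1)%g = (v == s i) by rewrite -{1}(simpleV i) divg_eq1.
  have -> : (s i * v == 1)%g = (v == s i).
    by rewrite -(inj_eq (mulgI (s i))) simpleK mulg1.
  have [->|ne_v] := eqVneq v (s i).
    by rewrite !simple_mulss; case: eqP; rewrite ?Dzero.
  by rewrite act0 !if_same; case: eqP; rewrite ?Dzero.
rewrite rcons_cons !skew_cons !IHb DD !mulgA.
have := cox_length_left j (v * s i)%g; have := cox_length_left j v.
have := cox_length_right i (s j * v)%g; have := cox_length_right i v.
rewrite !mulgA.
case=> l1; case=> l2; case=> l3; case=> l4; rewrite ?mulgA in l1 l2 l3 l4;
  rewrite ?Dzero ?actD ?act0 ?addr0 //;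
  try by move: l1 l2 l3 l4; set x := len v; set y := len (v * s i)%g;
  set z := len (s j * v)%g; set t := len (s j * v * s i)%g; clearbody x y z t; lia.
- by rewrite addrACA.
- by rewrite addrAC.
Qed.

Lemma skew_support b v f : (size b < len v)%N -> skew b v f = 0.
Proof.
elim: b v => [|i b IHb] v /= lt_v.
  by rewrite skew_nil; case: eqP lt_v => // ->; rewrite cox_length1.
rewrite skew_cons IHb ?Dzero ?add0r; last by apply: leq_trans lt_v.
by case: cox_length_left => // lv; rewrite IHb ?act0 //; lia.
Qed.

Lemma skew_top b w f : reduced_expr b w -> skew b w f = act w f.
Proof.
elim: b w => [|i b IHb] w.
  by rewrite reduced_expr_nil skew_nil => /eqP->; rewrite eqxx act1.
rewrite reduced_expr_cons => /andP[red_b down].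
rewrite skew_cons down (IHb _ red_b) skew_support ?Dzero ?add0r -?act_comp ?simpleK //.
by have [_ ->] := reduced_exprP red_b.
Qed.

Lemma skew_duality c v w b f :
    reduced_expr c w -> reduced_expr b (w0 * v)%g ->
  skew c v f = act w0 (skew b (w0 * w)%g f).
Proof.
have lw0 := @cox_length_longestM W.
elim/last_ind: c v w b f => [|c i IHc] v w b f.
  rewrite reduced_expr_nil skew_nil => /eqP -> red_b; rewrite mulg1.
  have [v1|/eqP ne_v1] := eqVneq v 1%g.
    by rewrite v1 mulg1 in red_b; rewrite (skew_top _ red_b) -act_comp longest_mulss act1.
  rewrite skew_support ?act0 //; have [_ ->] := reduced_exprP red_b.
  rewrite ltnNge; apply/negP=> le_v; case: ne_v1; apply: cox_length_eq0.
  by have := lw0 v; lia.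
rewrite reduced_expr_rcons => /andP[red_c down].
set y := (w0 * (w * s i))%g => red_b.
have ys_eq : (w0 * w = y * s i)%g by rewrite /y mulgA simpleKr.
have down_y : (len (y * s i)%g < len y)%N.
  by rewrite -ys_eq cox_length_longest_lt.
rewrite ys_eq.
rewrite skew_rcons (IHc _ _ _ _ red_c red_b) -/y.
case: cox_length_right => lv.
  have red_bi : reduced_expr (rcons b i) (w0 * (v * s i))%g.
    rewrite reduced_expr_rcons !mulgA simpleKr red_b -mulgA.
    by rewrite cox_length_longest_lt lv /=.
  (* The longer word ends in i, and its recursion contains the wanted term. *)
  rewrite (IHc _ _ _ _ red_c red_bi) -/y skew_rcons down_y actK Ds skewN -actD.
  by rewrite addNKr.
rewrite addr0; congr act.
(* Here b may be replaced by a reduced word that ends in i. *)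
set d := reduced_word (w0 * v * s i)%g.
have red_d : reduced_expr (rcons d i) (w0 * v)%g.
  by rewrite reduced_expr_rcons reduced_wordP -mulgA cox_length_longest_lt lv /=.
rewrite !(skew_reduced _ _ red_b red_d) !skew_rcons simpleKr down_y Dsq sD skew0 add0r.
by rewrite ltnNge (ltnW down_y) addr0.
Qed.

End SkewOperators.

(** * Divided differences over a domain *)

Section DividedDifference.
Local Open Scope ring_scope.
Set Implicit Arguments.
Unset Strict Implicit.

Variables (A : idomainType) (l : A) (sigma : A -> A).
Hypothesis l_neq0 : l != 0.
Hypothesis sigmaD : {morph sigma : f g / f + g}.
Hypothesis sigmaM : {morph sigma : f g / f * g}.

Let sigma0 : sigma 0 = 0.
Proof. by apply: (addrI (sigma 0)); rewrite -sigmaD !addr0. Qed.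

Let sigmaN f : sigma (- f) = - sigma f.
Proof. by apply: (addrI (sigma f)); rewrite -sigmaD !subrr. Qed.

(** The relation between f and its divided difference g along l: in this form
    existence, uniqueness and the calculus of divided differences can be
    discussed without a division. *)
Definition sigma_quotient f g := l * g = f - sigma f.

Lemma sigma_quotientD f g f' g' : sigma_quotient f f' -> sigma_quotient g g' ->
  sigma_quotient (f + g) (f' + g').
Proof.
by rewrite /sigma_quotient => Ef Eg; rewrite mulrDr Ef Eg sigmaD opprD addrACA.
Qed.

Lemma sigma_quotientM f g f' g' : sigma_quotient f f' -> sigma_quotient g g' ->
  sigma_quotient (f * g) (f' * g + sigma f * g').
Proof.
rewrite /sigma_quotient => Ef Eg.
by rewrite mulrDr mulrA Ef mulrCA Eg sigmaM mulrBl mulrBr addrA subrK.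
Qed.

Lemma sigma_quotient_inj f g g' : sigma_quotient f g -> sigma_quotient f g' -> g = g'.
Proof. by rewrite /sigma_quotient => <- /(mulfI l_neq0). Qed.

Hypothesis sigmaK : involutive sigma.
Hypothesis sigma_l : sigma l = - l.

Lemma sigma_quotient_fixed f g : sigma_quotient f g -> sigma g = g.
Proof.
rewrite /sigma_quotient => Eg; apply: (mulfI l_neq0); apply: oppr_inj.
by rewrite -mulNr -sigma_l -sigmaM Eg sigmaD sigmaN sigmaK opprB.
Qed.

Lemma sigma_quotient_sigma f g : sigma_quotient f g -> sigma_quotient (sigma f) (- g).
Proof. by rewrite /sigma_quotient => Eg; rewrite mulrN Eg sigmaK opprB. Qed.

Lemma sigma_quotient_sq f g : sigma_quotient f g -> sigma_quotient g 0.
Proof. by move/sigma_quotient_fixed=> Eg; rewrite /sigma_quotient Eg mulr0 subrr. Qed.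

End DividedDifference.

(** * The geometric representation and its action on polynomials *)

Section GeometricRepresentation.
Local Open Scope ring_scope.
Set Implicit Arguments.
Unset Strict Implicit.

Variables (R : realType) (W : finCoxeterSystem).
Notation n := (cox_rank W).
Notation hR := 'cV[R]_n.
Notation Sh := {mpoly R[i][n]}.
Variable rho : mx_representation R [set: W] n.
Hypothesis rho_geo : is_geometric rho.
Notation s := (@simple_refl W).
Notation wp := (@word_prod W).
Notation e := (@simple_root R W).
Notation B := (@Bform R W).
Notation lf := (@linear_form R W).
Implicit Types (i j : 'I_n) (x y : hR) (u v w : W) (f g h : Sh).

Lemma BformDl x y z : B (x + y) z = B x z + B y z.
Proof. by rewrite /Bform linearD !mulmxDl mxE. Qed.
Lemma BformZl a x y : B (a *: x) y = a * B x y.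
Proof. by rewrite /Bform linearZ -!scalemxAl mxE. Qed.
Lemma BformDr x y z : B x (y + z) = B x y + B x z.
Proof. by rewrite /Bform !mulmxDr mxE. Qed.
Lemma BformZr a x y : B x (a *: y) = a * B x y.
Proof. by rewrite /Bform -!scalemxAr mxE. Qed.
Lemma BformNl x y : B (- x) y = - B x y.
Proof. by rewrite -scaleN1r BformZl mulN1r. Qed.
Lemma BformNr x y : B x (- y) = - B x y.
Proof. by rewrite -scaleN1r BformZr mulN1r. Qed.

Lemma gram_sym : (gram R W)^T = gram R W.
Proof. by apply/matrixP=> i j; rewrite !mxE order_simpleC. Qed.

Lemma Bform_sym x y : B x y = B y x.
Proof.
rewrite /Bform -[x^T *m _ *m y]trmxK [LHS]mxE !trmx_mul gram_sym.
by rewrite trmxK mulmxA.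
Qed.

Lemma Bform_simple i j :
  B (e i) (e j) = - cos (pi / (#[(s i * s j)%g]%g)%:R).
Proof.
by rewrite /Bform /simple_root trmx_delta -(rowE i) -(colE j) !mxE.
Qed.

Lemma Bform_simpleii i : B (e i) (e i) = 1.
Proof. by rewrite Bform_simple simple_mulss order1 divr1 cospi opprK. Qed.

Lemma repM u v x : rho (u * v)%g *m x = rho u *m (rho v *m x).
Proof. by rewrite repr_mxM ?inE // mulmxA. Qed.

Lemma rep1 x : rho 1%g *m x = x.
Proof. by rewrite repr_mx1 mul1mx. Qed.

Lemma repK u x : rho u^-1%g *m (rho u *m x) = x.
Proof. by rewrite -repM mulVg rep1. Qed.

Lemma Bform_rep u x y : B (rho u *m x) (rho u *m y) = B x y.
Proof.
have [<- _] := reduced_exprP (reduced_wordP u).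
elim: (reduced_word u) => [|i b IHb]; first by rewrite word_prod_nil !rep1.
rewrite word_prod_cons !repM -[RHS]IHb !rho_geo.
move: (rho _ *m x) (rho _ *m y) => {IHb}x {}y.
rewrite !(BformDl, BformDr, BformNl, BformNr, BformZl, BformZr) Bform_simpleii.
by rewrite (Bform_sym (e i)); ring.
Qed.

Lemma Bform_refl i x y :
  B (rho (s i) *m x) y = B x y - 2 * B x (e i) * B (e i) y.
Proof. by rewrite rho_geo BformDl BformNl BformZl. Qed.

(** The recursion of the coefficients of a root of a dihedral group in terms of
    its two simple roots. *)
Lemma sin_recur (a : R) (k : nat) :
  2 * cos a * sin (k.+1%:R * a) - sin (k%:R * a) = sin (k.+2%:R * a).
Proof.
rewrite (_ : k.+2%:R * a = k.+1%:R * a + a); last by rewrite -natr1; ring.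
rewrite (_ : k%:R * a = k.+1%:R * a - a); last by rewrite -natr1; ring.
by rewrite sinB sinD; ring.
Qed.

(** The root obtained from e i by k alternating reflections is, up to the factor
    sin a, the combination of the two simple roots with the coefficients
    sin ((k + 1) a) and sin (k a); it is tested here against x. *)
Lemma dihedral_sine i j (k : nat) x : let a := pi / #[(s i * s j)%g]%g%:R in
  sin a * B (rho (wp (alt j i k)) *m x) (e i) =
  sin (k.+1%:R * a) * B x (e (if odd k then j else i)) +
  sin (k%:R * a) * B x (e (if odd k then i else j)).
Proof.
move=> a; have Bij : B (e i) (e j) = - cos a by rewrite Bform_simple.
elim: k x => [|k IHk] x.
  by rewrite word_prod_nil rep1 mul1r mul0r sin0 mul0r addr0.
rewrite alt_rcons word_prod_rcons repM IHk !Bform_refl -sin_recur /=.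
case: (odd k); rewrite /= ?Bform_simpleii ?Bij ?(Bform_sym (e j)) ?Bij; ring.
Qed.

(** At k = m - 1 the coefficients are sin pi = 0 and sin (pi - a) = sin a. *)
Lemma dihedral_root i j x : i != j ->
  B (rho (wp (alt j i #[(s i * s j)%g]%g.-1)) *m x) (e i) =
  B x (e (if odd #[(s i * s j)%g]%g.-1 then i else j)).
Proof.
move=> /simple_rot_gt1; set m := #[_]%g => m_gt1.
have := dihedral_sine i j m.-1 x; rewrite /= -/m prednK ?(ltnW m_gt1) //.
set a := pi / m%:R.
have m_gt0 : 0 < m%:R :> R by rewrite ltr0n ltnW.
have a_pi : m%:R * a = pi by rewrite mulrC divfK // gt_eqF.
have sin_a : 0 < sin a.
  apply: sin_gt0_pi; rewrite divr_gt0 ?pi_gt0 //= ltr_pdivrMr //.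
  by rewrite ltr_pMr ?pi_gt0 // ltr1n.
rewrite a_pi sinpi mul0r add0r.
rewrite (_ : m.-1%:R * a = pi - a); last first.
  by rewrite -a_pi -[in RHS](prednK (ltnW m_gt1)) -natr1; ring.
rewrite sinB sinpi cospi mul0r sub0r mulN1r opprK.
by apply: mulfI; rewrite gt_eqF.
Qed.

(** The pair chosen in the definition of [root_reflection] may differ from
    (u, i), but all choices act as the orthogonal reflection in the root. *)
Lemma root_reflectionE u i x : let a := rho u *m e i in
  rho (root_reflection rho a) *m x = x - (2 * B x a) *: a.
Proof.
move=> a; rewrite /root_reflection.
case: pickP => [[v j] /= /eqP eq_a|/(_ (u, i))]; last by rewrite eqxx.
rewrite !repM rho_geo mulmxBr -scalemxAr eq_a -{1}repM mulgV rep1.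
congr (_ - (2 * _) *: _).
by rewrite -[LHS](Bform_rep v) -repM mulgV rep1 eq_a.
Qed.

Lemma linear_formD x y : lf (x + y) = lf x + lf y.
Proof.
rewrite /linear_form -big_split; apply: eq_bigr => j _.
by rewrite mxE rmorphD scalerDl.
Qed.

Lemma linear_formZ a x : lf (a *: x) = (a%:C)%C *: lf x.
Proof.
rewrite /linear_form scaler_sumr; apply: eq_bigr => j _.
by rewrite mxE rmorphM scalerA.
Qed.

Lemma linear_formB x y : lf (x - y) = lf x - lf y.
Proof. by rewrite -scaleN1r linear_formD linear_formZ rmorphN1 scaleN1r. Qed.

Lemma linear_form_simple i : lf (e i) = 'X_i.
Proof.
rewrite /linear_form /simple_root (bigD1 i) //= mxE !eqxx scale1r.
by rewrite big1 ?addr0 // => j ne_ji; rewrite mxE (negPf ne_ji) scale0r.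
Qed.

Lemma linear_form_eq0 x : lf x = 0 -> x = 0.
Proof.
move=> x0; apply/matrixP=> j k; rewrite ord1 !mxE.
have: (lf x)@_U_(j) = 0 by rewrite x0 mcoeff0.
rewrite /linear_form raddf_sum /= (bigD1 j) //= mcoeffZ mcoeffX eqxx mulr1.
rewrite big1 ?addr0 => [|l ne_lj]; last first.
  by rewrite mcoeffZ mcoeffX eq_mnm1 (negPf ne_lj) mulr0.
by case.
Qed.

Notation act := (actS rho).

Lemma actSD u : {morph act u : f g / f + g}. Proof. exact: raddfD. Qed.
Lemma actSB u : {morph act u : f g / f - g}. Proof. exact: raddfB. Qed.
Lemma actSM u : {morph act u : f g / f * g}. Proof. exact: rmorphM. Qed.
Lemma actSC u (c : R[i]) : act u c%:MP = c%:MP. Proof. exact: comp_mpolyC. Qed.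

Lemma actS_lf u x : act u (lf x) = lf (rho u *m x).
Proof.
have actX i : act u 'X_i = lf (rho u *m e i).
  by rewrite /actS comp_mpolyXU -tnth_nth tnth_mktuple.
rewrite /linear_form /actS raddf_sum /=.
rewrite [in RHS](_ : x = \sum_j x j 0 *: e j); last first.
  rewrite [LHS]matrix_sum_delta; apply: eq_bigr => j _.
  by rewrite bigop.big_ord1.
rewrite mulmx_sumr -/(lf _).
rewrite (big_morph lf linear_formD (_ : lf 0 = 0)); last first.
  by rewrite /linear_form big1 // => j _; rewrite mxE scale0r.
by apply: eq_bigr => j _; rewrite comp_mpolyZ -/(act u 'X_j) actX -scalemxAr linear_formZ.
Qed.

Lemma linear_form_ind (P : Sh -> Prop) :
    (forall c : R[i], P c%:MP) -> (forall x f, P f -> P (lf x * f)) ->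
    (forall f g, P f -> P g -> P (f + g)) ->
  forall f, P f.
Proof.
move=> PC Plf PD; elim/mpolyind => [|c m f _ _ Pf]; first by rewrite -mpolyC0.
apply: PD => //; rewrite -mul_mpolyC mulrC mpolyXE_id.
pose Q g := forall h, P h -> P (g * h); suff : Q (\prod_(i < n) 'X_i ^+ m i) by apply.
have Q1 : Q 1 by move=> h; rewrite mul1r.
have QM g h : Q g -> Q h -> Q (g * h) by move=> Qg Qh p Pp; rewrite -mulrA; apply/Qg/Qh.
elim/big_ind: _ => [|f' g'|i _] //; first exact: QM.
elim: (m i) => [|k IHk]; first by rewrite expr0.
by rewrite exprS; apply: QM => // h; rewrite -linear_form_simple; apply: Plf.
Qed.

Lemma mpoly_algebra_ind (P : Sh -> Prop) :
    (forall c : R[i], P c%:MP) -> (forall i, P 'X_i) ->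
    (forall f g, P f -> P g -> P (f + g)) -> (forall f g, P f -> P g -> P (f * g)) ->
  forall f, P f.
Proof.
move=> PC PX PD PM; elim/mpolyind => [|c m f _ _ Pf].
  by rewrite -mpolyC0.
apply: PD => //; rewrite -mul_mpolyC; apply: (PM) => //.
rewrite mpolyXE_id; elim/big_ind: _ => [|f' g'|i _]; first by rewrite -mpolyC1.
  exact: PM.
by elim: (m i) => [|k IHk]; [rewrite expr0 -mpolyC1 | rewrite exprS; apply: PM].
Qed.

Lemma actS1 f : act 1%g f = f.
Proof.
elim/mpoly_algebra_ind: f => [c|i|f g IHf IHg|f g IHf IHg].
- by rewrite actSC.
- by rewrite -linear_form_simple actS_lf rep1.
- by rewrite actSD IHf IHg.
- by rewrite actSM IHf IHg.
Qed.

Lemma actS_comp u v f : act (u * v)%g f = act u (act v f).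
Proof.
elim/mpoly_algebra_ind: f => [c|i|f g IHf IHg|f g IHf IHg].
- by rewrite !actSC.
- by rewrite -linear_form_simple !actS_lf repM.
- by rewrite !actSD IHf IHg.
- by rewrite !actSM IHf IHg.
Qed.

Definition is_root x := exists u i, x = rho u *m e i.

Lemma is_root_simple i : is_root (e i).
Proof. by exists 1%g, i; rewrite rep1. Qed.

Lemma is_root_rep u x : is_root x -> is_root (rho u *m x).
Proof. by case=> v [i ->]; exists (u * v)%g, i; rewrite repM. Qed.

Lemma root_neq0 x : is_root x -> lf x != 0.
Proof.
case=> u [i ->]; apply/eqP => /linear_form_eq0 /(congr1 (mulmx (rho u^-1%g))).
rewrite repK mulmx0 => /matrixP/(_ i 0); rewrite !mxE !eqxx => /eqP.
by rewrite oner_eq0.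
Qed.

Notation refl := (root_reflection rho).

Lemma rep_root_reflection x y : is_root x -> rho (refl x) *m y = y - (2 * B y x) *: x.
Proof. by case=> u [i ->]; exact: root_reflectionE. Qed.

Notation quo x := (sigma_quotient (lf x) (act (refl x))).

Lemma root_quotient_exists x f : is_root x -> exists g, quo x f g.
Proof.
move=> root_x; elim/mpoly_algebra_ind: f => [c|i|f g [f' Ef] [g' Eg]|f g [f' Ef] [g' Eg]].
- by exists 0; rewrite /sigma_quotient actSC mulr0 subrr.
- exists (2 * B (e i) x)%:C%C%:MP; rewrite /sigma_quotient.
  rewrite -linear_form_simple actS_lf rep_root_reflection // linear_formB linear_formZ.
  by rewrite opprB addrCA subrr addr0 mulrC mul_mpolyC.
- by exists (f' + g'); apply: sigma_quotientD => //; apply: actSD.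
- by exists (f' * g + act (refl x) f * g'); apply: sigma_quotientM => //; apply: actSM.
Qed.

Notation dd := (divdiffS rho).

Lemma divdiffSP x f : is_root x -> quo x f (dd x f).
Proof.
move=> /root_quotient_exists-/(_ f) ex; rewrite /divdiffS.
by case: xgetP => [_ -> //|]; case: ex => g /[swap] /(_ g).
Qed.

Lemma divdiffS_eq x f g : is_root x -> quo x f g -> dd x f = g.
Proof.
move=> root_x Eg.
exact (sigma_quotient_inj (root_neq0 root_x) (divdiffSP f root_x) Eg).
Qed.

Lemma divdiffSD x : is_root x -> {morph dd x : f g / f + g}.
Proof.
move=> root_x f g; apply: divdiffS_eq => //.
by apply: sigma_quotientD; [exact: actSD | exact: divdiffSP..].
Qed.

Lemma divdiffSM x f g : is_root x ->
  dd x (f * g) = dd x f * g + act (refl x) f * dd x g.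
Proof.
move=> root_x; apply: divdiffS_eq => //.
by apply: sigma_quotientM; [exact: actSM | exact: divdiffSP..].
Qed.

Lemma divdiffSC x (c : R[i]) : is_root x -> dd x c%:MP = 0.
Proof.
by move=> root_x; apply: divdiffS_eq; rewrite // /sigma_quotient mulr0 actSC subrr.
Qed.

Lemma divdiffS_lf x y : is_root x -> dd x (lf y) = (2 * B y x)%:C%C%:MP.
Proof.
move=> root_x; apply: divdiffS_eq => //; rewrite /sigma_quotient.
rewrite actS_lf rep_root_reflection // linear_formB linear_formZ.
by rewrite opprB addrCA subrr addr0 mulrC mul_mpolyC.
Qed.

(** The action on polynomials depends on u only through [rho u], so it does not
    see which of the elements acting as a given reflection [root_reflection]
    has picked. *)
Lemma eq_actS u v f : (forall x, rho u *m x = rho v *m x) -> act u f = act v f.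
Proof.
move=> eq_uv; elim/mpoly_algebra_ind: f => [c|i|f g IHf IHg|f g IHf IHg].
- by rewrite !actSC.
- by rewrite -linear_form_simple !actS_lf eq_uv.
- by rewrite !actSD IHf IHg.
- by rewrite !actSM IHf IHg.
Qed.

Lemma actS_reflection_conj u x f : is_root x ->
  act (refl (rho u *m x)) (act u f) = act u (act (refl x) f).
Proof.
move=> root_x; rewrite -!actS_comp; apply: eq_actS => y.
rewrite !repM rep_root_reflection ?rep_root_reflection ?Bform_rep //; last exact: is_root_rep.
by rewrite mulmxBr scalemxAr.
Qed.

Lemma act_divdiffS u x f : is_root x -> act u (dd x f) = dd (rho u *m x) (act u f).
Proof.
move=> root_x; apply/esym/divdiffS_eq; first exact: is_root_rep.
by rewrite /sigma_quotient -actS_lf -actSM (divdiffSP f root_x) actSB actS_reflection_conj.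
Qed.

Lemma actS_reflection_simple i f : act (refl (e i)) f = act (s i) f.
Proof.
by apply: eq_actS => x; rewrite rho_geo rep_root_reflection //; exact: is_root_simple.
Qed.

Lemma act_simpleK i : involutive (act (s i)).
Proof. by move=> f; rewrite -actS_comp simple_mulss actS1. Qed.

Lemma rep_simple_root i : rho (s i) *m e i = - e i.
Proof.
by rewrite rho_geo Bform_simpleii mulr1 scaler_nat mulr2n opprD addNKr.
Qed.

Lemma act_simple_root i : act (s i) (lf (e i)) = - lf (e i).
Proof.
rewrite actS_lf rep_simple_root -[- e i]add0r linear_formB.
by rewrite -[0](subrr (e i)) linear_formB subrr sub0r.
Qed.

Lemma divdiff_simpleP i f : sigma_quotient (lf (e i)) (act (s i)) f (dd (e i) f).
Proof.
by have := divdiffSP f (is_root_simple i); rewrite /sigma_quotient actS_reflection_simple.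
Qed.

Lemma divdiff_simple_eq i f g :
  sigma_quotient (lf (e i)) (act (s i)) f g -> dd (e i) f = g.
Proof.
move=> Eg.
exact (sigma_quotient_inj (root_neq0 (is_root_simple i)) (divdiff_simpleP i f) Eg).
Qed.

Lemma divdiff_simpleM i f g :
  dd (e i) (f * g) = dd (e i) f * g + act (s i) f * dd (e i) g.
Proof. by rewrite (divdiffSM f g (is_root_simple i)) actS_reflection_simple. Qed.

Lemma simple_divdiff i f : act (s i) (dd (e i) f) = dd (e i) f.
Proof.
apply: (sigma_quotient_fixed (root_neq0 (is_root_simple i)) (actSD _) (actSM _)
  (act_simpleK i) (act_simple_root i)).
exact: divdiff_simpleP.
Qed.

Lemma divdiff_simple i f : dd (e i) (act (s i) f) = - dd (e i) f.
Proof.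
exact/divdiff_simple_eq/(sigma_quotient_sigma (act_simpleK i))/divdiff_simpleP.
Qed.

Lemma divdiff_sq i f : dd (e i) (dd (e i) f) = 0.
Proof.
apply: divdiff_simple_eq.
exact: (sigma_quotient_sq (root_neq0 (is_root_simple i)) (actSD _) (actSM _)
  (act_simpleK i) (act_simple_root i) (divdiff_simpleP i f)).
Qed.

End GeometricRepresentation.

(** * Subsets of a nonempty ordinal *)

Section OrdinalSubsets.
Set Implicit Arguments.
Unset Strict Implicit.

Variable n : nat.
Implicit Types (J : {set 'I_n}).
Local Open Scope set_scope.

(** A subset of the positions of a word i b either misses or contains the first
    position; these are the two ways to obtain it from a subset of the positions
    of b. *)
Definition lift_set J : {set 'I_n.+1} := lift ord0 @: J.
Definition cons_set J : {set 'I_n.+1} := ord0 |: lift_set J.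

Lemma mem_lift_set J j : (lift ord0 j \in lift_set J) = (j \in J).
Proof. by rewrite mem_imset //; exact: lift_inj. Qed.

Lemma ord0_lift_set J : (ord0 \in lift_set J) = false.
Proof. by apply/imsetP => -[j _ /eqP]; rewrite (negPf (neq_lift _ _)). Qed.

Lemma mem_lift_cons_set J j : (lift ord0 j \in cons_set J) = (j \in J).
Proof. by rewrite !inE mem_lift_set eq_sym (negPf (neq_lift _ _)). Qed.

Lemma ord0_cons_set J : ord0 \in cons_set J.
Proof. by rewrite !inE eqxx. Qed.

Lemma enum_set_filter m (A : {set 'I_m}) : enum A = [seq i <- enum 'I_m | i \in A].
Proof. by rewrite [in RHS]enumT. Qed.

Lemma enum_lift_set J : enum (lift_set J) = map (lift ord0) (enum J).
Proof.
rewrite !enum_set_filter enum_ordSl /= ord0_lift_set filter_map.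
by congr map; apply: eq_filter => j /=; rewrite mem_lift_set.
Qed.

Lemma enum_cons_set J : enum (cons_set J) = ord0 :: map (lift ord0) (enum J).
Proof.
rewrite !enum_set_filter enum_ordSl /= ord0_cons_set filter_map.
by congr (_ :: map _ _); apply: eq_filter => j /=; rewrite mem_lift_cons_set.
Qed.

Lemma setC_lift_set J : ~: lift_set J = cons_set (~: J).
Proof.
apply/setP=> i; rewrite inE; case: (unliftP ord0 i) => [j|] ->.
  by rewrite mem_lift_set mem_lift_cons_set inE.
by rewrite ord0_lift_set ord0_cons_set.
Qed.

Lemma setC_cons_set J : ~: cons_set J = lift_set (~: J).
Proof. by rewrite -{1}(finset.setCK J) -setC_lift_set finset.setCK. Qed.

Lemma big_set_ordS (A : nmodType) (P : pred {set 'I_n.+1}) (G : {set 'I_n.+1} -> A) :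
  (\sum_(J | P J) G J =
   \sum_(J : {set 'I_n} | P (lift_set J)) G (lift_set J) +
   \sum_(J : {set 'I_n} | P (cons_set J)) G (cons_set J))%R.
Proof.
have part (K : {set 'I_n.+1}) (J := [set j | lift ord0 j \in K]) :
    K = if ord0 \in K then cons_set J else lift_set J.
  apply/setP=> i; case: ifPn => K0; case: (unliftP ord0 i) => [j|] ->;
    rewrite ?mem_lift_set ?mem_lift_cons_set ?ord0_lift_set ?ord0_cons_set ?inE //.
  exact/negbTE.
have liftK : cancel lift_set (fun K => [set j | lift ord0 j \in K]).
  by move=> J; apply/setP=> j; rewrite inE mem_lift_set.
have consK : cancel cons_set (fun K => [set j | lift ord0 j \in K]).
  by move=> J; apply/setP=> j; rewrite inE mem_lift_cons_set.
rewrite (bigID (fun K : {set 'I_n.+1} => ord0 \in K)) /= GRing.addrC; congr GRing.add.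
  rewrite (reindex_onto lift_set (fun K => [set j | lift ord0 j \in K])) /=.
    by apply: eq_bigl => J; rewrite ord0_lift_set liftK eqxx !andbT.
  by move=> K /andP[_ K0]; rewrite [RHS]part (negPf K0).
rewrite (reindex_onto cons_set (fun K => [set j | lift ord0 j \in K])) /=.
  by apply: eq_bigl => J; rewrite ord0_cons_set consK eqxx !andbT.
by move=> K /andP[_ K0]; rewrite [RHS]part K0.
Qed.

End OrdinalSubsets.

(** * The coinvariant algebra *)

Section Coinvariants.
Local Open Scope quotient_scope.
Local Open Scope ring_scope.
Set Implicit Arguments.
Unset Strict Implicit.

Variables (R : realType) (W : finCoxeterSystem).
Notation n := (cox_rank W).
Notation hR := 'cV[R]_n.
Notation Sh := {mpoly R[i][n]}.
Variable rho : mx_representation R [set: W] n.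
Hypothesis rho_geo : is_geometric rho.
Notation s := (@simple_refl W).
Notation len := (@cox_length W).
Notation wp := (@word_prod W).
Notation e := (@simple_root R W).
Notation w0 := (longest_elt W).
Notation act := (actS rho).
Notation dd := (divdiffS rho).
Notation SW := (coinvariant rho).
Implicit Types (i : 'I_n) (x y : hR) (u v w : W) (f g h : Sh) (b c : seq 'I_n).

(* On polynomials, with the simple divided differences. *)
Notation skewS := (@skew W Sh act (fun i => dd (e i))).

Lemma invariant_constC (a : R[i]) : invariant_const act (fun i => dd (e i)) (a%:MP : Sh).
Proof.
split=> [u|i]; first exact: actSC.
exact: divdiffSC (is_root_simple rho i).
Qed.

Lemma skewS_duality c v w b f :
    reduced_expr c w -> reduced_expr b (w0 * v)%g ->
  skewS c v f = act w0 (skewS b (w0 * w)%g f).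
Proof.
have rt i := is_root_simple rho i.
apply: (@skew_duality W Sh act (fun i => dd (e i)) (actSD rho) (actSM rho) (actS1 rho)
  (actS_comp rho) (fun i => divdiffSD rho_geo (rt i)) (divdiff_simpleM rho_geo)
  (simple_divdiff rho_geo) (divdiff_simple rho_geo) (divdiff_sq rho_geo)
  hR (@linear_form R W)).
- move=> i u x; rewrite actS_lf divdiffS_lf //; exact: invariant_constC.
- by move=> i j x ne_ij m; rewrite actS_lf !divdiffS_lf // (dihedral_root rho_geo).
- by move=> P PC; apply: linear_form_ind => a; apply/PC/invariant_constC.
Qed.

(** An operator that is linear over the invariants, even in the weak sense
    below, preserves the ideal generated by some of them. *)
Lemma coinv_ideal_lift (F : Sh -> Sh) : {morph F : f g / f + g} ->
    (forall g h, W_invariant rho h -> exists g', F (g * h) = g' * h) ->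
  forall f, coinv_ideal rho f -> coinv_ideal rho (F f).
Proof.
move=> FD FM f /asboolP[l [lP ->]]; apply/asboolP.
have F0 : F 0 = 0 by apply: (addrI (F 0)); rewrite -FD !addr0.
rewrite (big_morph F FD F0); elim: l lP => [|[g h] l IHl] lP.
  by exists [::]; split=> //; rewrite !big_nil.
have [|l' [l'P El']] := IHl; first by move=> gh gh_l; apply: lP; rewrite inE gh_l orbT.
have [inv_h h0] := lP _ (mem_head _ _).
have [g' Eg'] := FM g h inv_h.
exists ((g', h) :: l'); split; last by rewrite !big_cons El' Eg'.
by move=> gh; rewrite inE => /predU1P[->|/l'P].
Qed.

Lemma lift_op1_pi (F : Sh -> Sh) : {morph F : f g / f + g} ->
    (forall g h, W_invariant rho h -> exists g', F (g * h) = g' * h) ->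
  forall f, lift_op1 SW F (\pi_SW f) = \pi_SW (F f).
Proof.
move=> FD FM f; rewrite -lock; apply/eqP; rewrite -Quotient.idealrBE.
have FB : F (repr (\pi_SW f)) - F f = F (repr (\pi_SW f) - f).
  by apply/eqP; rewrite subr_eq -FD subrK.
rewrite FB; apply: coinv_ideal_lift => //.
suff : repr (\pi_SW f) - f \in (coinv_ideal rho : idealr Sh) by [].
by rewrite Quotient.idealrBE reprK.
Qed.

Lemma lift_op1D (F : Sh -> Sh) : {morph F : f g / f + g} ->
    (forall g h, W_invariant rho h -> exists g', F (g * h) = g' * h) ->
  {morph lift_op1 SW F : x y / x + y}.
Proof.
move=> FD FM x y; rewrite -[x]reprK -[y]reprK -rmorphD !(lift_op1_pi FD FM).
by rewrite FD rmorphD.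
Qed.

Lemma act_invariant_linear u g h : W_invariant rho h ->
  exists g', act u (g * h) = g' * h.
Proof. by move=> inv_h; exists (act u g); rewrite actSM inv_h. Qed.

Lemma divdiff_invariant_linear x g h : is_root rho x -> W_invariant rho h ->
  exists g', dd x (g * h) = g' * h.
Proof.
move=> rt_x inv_h; exists (dd x g); rewrite divdiffSM //.
rewrite (divdiffS_eq rho_geo rt_x (_ : sigma_quotient _ _ h 0)) ?mulr0 ?addr0 //.
by rewrite /sigma_quotient inv_h mulr0 subrr.
Qed.

Lemma coinv_act_pi u f : coinv_act u (\pi_SW f) = \pi_SW (act u f).
Proof. exact: lift_op1_pi (actSD rho u) (act_invariant_linear u) f. Qed.

Lemma coinv_divdiff_pi x f : is_root rho x ->
  coinv_divdiff x (\pi_SW f) = \pi_SW (dd x f).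
Proof.
move=> rt_x.
exact: lift_op1_pi (divdiffSD rho_geo rt_x)
  (fun g h => @divdiff_invariant_linear x g h rt_x) f.
Qed.

Lemma coinv_actD u : {morph coinv_act (rho := rho) u : p q / p + q}.
Proof. exact: lift_op1D (actSD rho u) (act_invariant_linear u). Qed.

Lemma coinv_divdiffD x : is_root rho x ->
  {morph coinv_divdiff (rho := rho) x : p q / p + q}.
Proof.
move=> rt_x.
exact: lift_op1D (divdiffSD rho_geo rt_x)
  (fun g h => @divdiff_invariant_linear x g h rt_x).
Qed.

Lemma additive_sum (F : SW -> SW) (T : finType) (P : pred T) (G : T -> SW) :
  {morph F : p q / p + q} -> F (\sum_(t | P t) G t) = \sum_(t | P t) F (G t).
Proof.
by move=> FD; apply: big_morph => //; apply: (addrI (F 0)); rewrite -FD !addr0.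
Qed.

Lemma tnth_lift0 (T : Type) (a : T) (b : seq T) (j : 'I_(size b)) :
  tnth (in_tuple (a :: b)) (lift ord0 j) = tnth (in_tuple b) j.
Proof. by rewrite !(tnth_nth a). Qed.

Lemma subword_lift i b (J : {set 'I_(size b)}) :
  @subword W (i :: b) (lift_set J) = subword J.
Proof.
rewrite /subword enum_lift_set -map_comp; apply: eq_map => j.
exact: tnth_lift0.
Qed.

Lemma subword_cons i b (J : {set 'I_(size b)}) :
  @subword W (i :: b) (cons_set J) = i :: subword J.
Proof.
rewrite /subword enum_cons_set /= -map_comp; congr (_ :: _); apply: eq_map => j.
exact: tnth_lift0.
Qed.

Lemma comp_ops_enum k (J : {set 'I_k}) (F : 'I_k -> SW -> SW) :
  comp_ops J F = \big[comp/id]_(j <- enum J) F j.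
Proof. by rewrite /comp_ops -big_filter [index_enum _]unlock. Qed.

Lemma comp_ops_lift k (J : {set 'I_k}) (F : 'I_k.+1 -> SW -> SW) :
  comp_ops (lift_set J) F = comp_ops J (fun j => F (lift ord0 j)).
Proof. by rewrite !comp_ops_enum enum_lift_set big_map. Qed.

Lemma comp_ops_cons k (J : {set 'I_k}) (F : 'I_k.+1 -> SW -> SW) p :
  comp_ops (cons_set J) F p = F ord0 (comp_ops J (fun j => F (lift ord0 j)) p).
Proof. by rewrite !comp_ops_enum enum_cons_set big_cons big_map. Qed.

Lemma cons_setT k : cons_set [set: 'I_k] = [set: 'I_k.+1].
Proof.
apply/setP=> i; rewrite finset.in_setT; case: (unliftP ord0 i) => [j|] ->.
  by rewrite mem_lift_cons_set finset.in_setT.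
by rewrite ord0_cons_set.
Qed.

Lemma eq_comp_ops k (J : {set 'I_k}) (F G : 'I_k -> SW -> SW) :
  (forall j, F j = G j) -> comp_ops J F = comp_ops J G.
Proof. by move=> eqFG; apply: eq_bigr. Qed.

Definition word_ops (G : 'I_n -> bool -> SW -> SW) b (J : {set 'I_(size b)}) :=
  comp_ops [set: 'I_(size b)] (fun j => G (tnth (in_tuple b) j) (j \in J)).

Lemma word_ops_lift G i b (J : {set 'I_(size b)}) p :
  @word_ops G (i :: b) (lift_set J) p = G i false (word_ops G J p).
Proof.
rewrite /word_ops -[X in comp_ops X]cons_setT comp_ops_cons ord0_lift_set.
congr (G i false _); congr (_ p); apply: eq_comp_ops => j.
by rewrite mem_lift_set tnth_lift0.
Qed.

Lemma word_ops_cons G i b (J : {set 'I_(size b)}) p :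
  @word_ops G (i :: b) (cons_set J) p = G i true (word_ops G J p).
Proof.
rewrite /word_ops -[X in comp_ops X]cons_setT comp_ops_cons ord0_cons_set.
congr (G i true _); congr (_ p); apply: eq_comp_ops => j.
by rewrite mem_lift_cons_set tnth_lift0.
Qed.

Definition skew_factor i (in_J : bool) : SW -> SW :=
  if in_J then coinv_act (s i) else coinv_divdiff (e i).

Lemma skew_summandE b (J : {set 'I_(size b)}) :
  skew_summand (rho := rho) J = word_ops skew_factor J.
Proof. by []. Qed.

Lemma skew_summand_lift i b (J : {set 'I_(size b)}) p :
  @skew_summand R W rho (i :: b) (lift_set J) p =
  coinv_divdiff (e i) (skew_summand J p).
Proof. by rewrite !skew_summandE word_ops_lift. Qed.

Lemma skew_summand_cons i b (J : {set 'I_(size b)}) p :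
  @skew_summand R W rho (i :: b) (cons_set J) p =
  coinv_act (s i) (skew_summand J p).
Proof. by rewrite !skew_summandE word_ops_cons. Qed.

Lemma set_ord0 (J : {set 'I_0}) : J = finset.set0.
Proof. by apply/setP=> -[]. Qed.

Lemma comp_ops0 (J : {set 'I_0}) (F : 'I_0 -> SW -> SW) p : comp_ops J F p = p.
Proof. by rewrite /comp_ops big_pred0 // => -[]. Qed.

Lemma subword_nil (J : {set 'I_0}) : @subword W [::] J = [::].
Proof. by rewrite /subword (set_ord0 J) enum_set0. Qed.

Lemma big_set_ord0 (P : pred {set 'I_0}) (G : {set 'I_0} -> SW) :
  \sum_(J | P J) G J = if P finset.set0 then G finset.set0 else 0.
Proof.
case: ifP => P0; last by rewrite big_pred0 // => J; rewrite (set_ord0 J).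
by rewrite (big_pred1 finset.set0) // => J; rewrite /= (set_ord0 J) P0 eqxx.
Qed.

Lemma coinv_piD f g : \pi_SW (f + g) = \pi_SW f + \pi_SW g.
Proof. exact: rmorphD. Qed.

Lemma coinv_pi0 : \pi_SW (0 : Sh) = 0.
Proof. exact: rmorph0. Qed.

Lemma skewS_cons i b v f : skewS (i :: b) v f = dd (e i) (skewS b v f) +
  if (len (s i * v)%g < len v)%N then act (s i) (skewS b (s i * v)%g f) else 0.
Proof. exact: skew_cons. Qed.

(** The sum over the subwords of i b splits according to the first letter, which
    gives the recursion of [skew]. *)
Lemma skew_sum b v f :
  \sum_(J : {set 'I_(size b)} | reduced_expr (subword J) v) skew_summand J (\pi_SW f) =
  \pi_SW (skewS b v f).
Proof.
elim: b v => [|i b IHb] v.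
  rewrite big_set_ord0 subword_nil reduced_expr_nil skew_nil /skew_summand comp_ops0.
  by case: ifP; rewrite // coinv_pi0.
rewrite big_set_ordS skewS_cons coinv_piD; congr (_ + _).
  rewrite -(coinv_divdiff_pi _ (is_root_simple rho i)) -IHb.
  rewrite (additive_sum _ _ (coinv_divdiffD (is_root_simple rho i))).
  apply: eq_big => J; first by rewrite subword_lift.
  by rewrite skew_summand_lift.
case: ifP => down; last first.
  by rewrite coinv_pi0 big_pred0 // => J; rewrite subword_cons reduced_expr_cons down andbF.
rewrite -coinv_act_pi -IHb (additive_sum _ _ (coinv_actD _)).
apply: eq_big => J; first by rewrite subword_cons reduced_expr_cons down andbT.
by rewrite skew_summand_cons.
Qed.

Lemma coinv_act_comp u v (p : SW) : coinv_act (u * v)%g p = coinv_act u (coinv_act v p).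
Proof. by rewrite -[p]reprK !coinv_act_pi actS_comp. Qed.

Lemma coinv_act1 (p : SW) : coinv_act 1%g p = p.
Proof. by rewrite -[p]reprK coinv_act_pi actS1. Qed.

(** For beta = e i and alpha = u^-1(beta): s_beta u d_alpha = s_beta d_beta u =
    d_beta u. *)
Lemma coinv_act_divdiff_conj u i (p : SW) :
  coinv_act (s i * u)%g (coinv_divdiff (rho u^-1%g *m e i) p) =
  coinv_divdiff (e i) (coinv_act u p).
Proof.
have rt_i := is_root_simple rho i; have rt_u := is_root_rep u^-1%g rt_i.
rewrite -[p]reprK (coinv_divdiff_pi _ rt_u) !coinv_act_pi.
rewrite (coinv_divdiff_pi _ rt_i); congr (\pi_SW _).
rewrite actS_comp (act_divdiffS rho_geo _ _ rt_u) -repM mulgV rep1.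
exact: simple_divdiff.
Qed.

Lemma word_root_lift i b (j : 'I_(size b)) :
  word_root rho (b := i :: b) (lift ord0 j) = word_root rho j.
Proof. by rewrite /word_root tnth_lift0. Qed.

Lemma word_root_ord0 i b :
  word_root rho (b := i :: b) ord0 = rho (wp b)^-1%g *m e i.
Proof. by rewrite /word_root /= drop0 word_prod_rev. Qed.

Lemma comp_ops_word_root_lift (G : hR -> SW -> SW) i b (J : {set 'I_(size b)}) p :
  comp_ops (lift_set J) (fun j => G (word_root rho (b := i :: b) j)) p =
  comp_ops J (fun j => G (word_root rho j)) p.
Proof.
rewrite comp_ops_lift; congr (_ p); apply: eq_comp_ops => j.
by rewrite word_root_lift.
Qed.

Lemma comp_ops_word_root_cons (G : hR -> SW -> SW) i b (J : {set 'I_(size b)}) p :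
  comp_ops (cons_set J) (fun j => G (word_root rho (b := i :: b) j)) p =
  G (rho (wp b)^-1%g *m e i) (comp_ops J (fun j => G (word_root rho j)) p).
Proof.
rewrite comp_ops_cons word_root_ord0; congr (G _ _).
congr (_ p); apply: eq_comp_ops => j.
by rewrite word_root_lift.
Qed.

(** Pulling the product of b through the composite of the d_(alpha_j), letter
    by letter: by [coinv_act_divdiff_conj] the first letter turns into d_beta if
    its position belongs to J, and it stays a reflection otherwise. *)
Lemma word_root_sum b v f :
  coinv_act (wp b) (\sum_(J : {set 'I_(size b)} | reduced_expr (subword (~: J)%SET) v)
     comp_ops J (fun j => coinv_divdiff (word_root rho j)) (\pi_SW f)) =
  \pi_SW (skewS b v f).
Proof.
elim: b v => [|i b IHb] v.
  rewrite big_set_ord0 subword_nil reduced_expr_nil skew_nil comp_ops0 word_prod_nil.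
  by rewrite coinv_act1; case: ifP; rewrite // coinv_pi0.
rewrite big_set_ordS skewS_cons coinv_piD addrC coinv_actD word_prod_cons; congr (_ + _).
  rewrite -(coinv_divdiff_pi _ (is_root_simple rho i)) -IHb.
  rewrite -coinv_act_divdiff_conj; congr coinv_act.
  rewrite (additive_sum _ _ (coinv_divdiffD (is_root_rep _ (is_root_simple rho i)))).
  apply: eq_big => J; first by rewrite setC_cons_set subword_lift.
  by rewrite comp_ops_word_root_cons.
case: ifP => down; last first.
  rewrite coinv_pi0 big_pred0 => [|J]; last first.
    by rewrite setC_lift_set subword_cons reduced_expr_cons down andbF.
  by rewrite -coinv_pi0 coinv_act_pi (actSC _ _ 0).
rewrite -coinv_act_pi // -IHb coinv_act_comp; congr (coinv_act _ (coinv_act _ _)).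
apply: eq_big => J; first by rewrite setC_lift_set subword_cons reduced_expr_cons down andbT.
by rewrite comp_ops_word_root_lift.
Qed.

End Coinvariants.

Local Open Scope ring_scope.

Theorem theorem1p10 (R : realType) (W : finCoxeterSystem)
    (rho : mx_representation R [set: W] (cox_rank W)) (rho_geo : is_geometric rho)
    (v w : W) (le_vw : bruhat v w)
    (b : seq 'I_(cox_rank W)) (b_red : reduced_expr b (longest_elt W * v)%g) :
  forall x : coinvariant rho,
    skew_divdiff w v x =
    \sum_(J : {set 'I_(size b)} |
            reduced_expr (subword (~: J)%SET) (longest_elt W * w)%g)
      comp_ops J (fun j => coinv_divdiff (word_root rho j)) x.
Proof.
move=> x; rewrite /skew_divdiff le_vw -[x]reprK skew_sum //.
rewrite (skewS_duality rho_geo _ (reduced_wordP w) b_red) -coinv_act_pi -word_root_sum //.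
rewrite -!coinv_act_comp; have [-> _] := reduced_exprP b_red.
by rewrite mulgA -(mulgA v^-1%g) longest_mulss mulg1 mulVg coinv_act1.
Qed.
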